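(* Let $1\le s\le 3$ and let $n=4k+r$ with $k\ge 1$ an integer and $r\in\{0,1,2,3\}$, and suppose $(n,s)\neq(4,3)$. Then the radio number of the generalized prism graph $Z_{n,s}$ is $$rn(Z_{n,s})=(n-1)\,\phi(n,s)+2,$$ where $\phi(n,s)$ is given by: for $s=1$: $\phi=k+2,\ k+2,\ k+3,\ k+2$ for $r=0,1,2,3$ respectively; for $s=2$: $\phi=k+1,\ k+2,\ k+2,\ k+3$ for $r=0,1,2,3$ respectively; for $s=3$: $\phi=k+2,\ k+1,\ k+2,\ k+2$ for $r=0,1,2,3$ respectively. In addition, $rn(Z_{3,3})=6$ and $rn(Z_{4,3})=9$.
   Context: The generalized prism graph $Z_{n,s}$ ($s\ge1$, $n\ge s$) is the simple graph with vertex set $\{(i,j): i=1,2,\ j=1,\dots,n\}$ in which $(i,j)$ is adjacent to $(i,j\pm1)$, and $(1,i)$ is adjacent to $(2,i+\sigma)$ for each integer $\sigma$ with $-\lfloor\frac{s-1}{2}\rfloor\le\sigma\le\lfloor\frac{s}{2}\rfloor$; second coordinates are read modulo $n$ in $\{1,\dots,n\}$. For a connected graph $G$, $d(u,v)$ is the graph distance and $\mathrm{diam}(G)$ the maximum distance. A radio labeling of $G$ is a function $c$ from $V(G)$ to the positive integers such that $d(u,v)+|c(u)-c(v)|\ge \mathrm{diam}(G)+1$ for all distinct vertices $u,v$. The span of $c$ is its maximum value, and the radio number $rn(G)$ is the minimum span over all radio labelings of $G$. *)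

(* Defs.v *)
From mathcomp Require Import all_boot all_order all_algebra.
Import GRing.Theory.

Set Implicit Arguments.
Unset Strict Implicit.
Unset Printing Implicit Defensive.

(** A finite simple graph is a symmetric irreflexive relation on a finType. *)

Section Graph.

Variables (T : finType) (e : rel T).

Definition walk (u v : T) (m : nat) : bool :=
  [exists p : m.-tuple T, path e u p && (last u p == v)].

(* The least length of a walk from u to v; a shortest walk has fewer than #|T|
   edges, so the search range is exhaustive.  The value is the junk value #|T|
   when u and v are not connected. *)
Definition gdist (u v : T) : nat := find (walk u v) (iota 0 #|T|).

Definition diam : nat := \max_(u : T) \max_(v : T) gdist u v.

(* `|a - b|%N is the absolute difference of naturals, not truncated. *)
Definition radio_labeling (c : T -> nat) : Prop :=
  (forall u, 0 < c u) /\
  (forall u v, u != v -> diam + 1 <= gdist u v + `|c u - c v|%N).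

Definition span (c : T -> nat) : nat := \max_(u : T) c u.

(* m = rn(G): m is the least span of a radio labeling. *)
Definition is_radio_number (m : nat) : Prop :=
  (exists2 c, radio_labeling c & span c = m) /\
  (forall c, radio_labeling c -> m <= span c).

End Graph.

(** Vertices of Z_(n,s): (i, j) with i = 0, 1 standing for 1, 2, and j the
    residue modulo n of the second coordinate (so n is represented by 0). *)
Notation prism_vertex n := ('I_2 * 'I_n)%type.

Section Prism.

Variables n s : nat.

Definition cycle_adj (u v : prism_vertex n) : bool :=
  (u.1 == v.1) &&
  ((v.2%:Z == u.2%:Z + 1 %[mod n])%Z || (v.2%:Z == u.2%:Z - 1 %[mod n])%Z).

(* The integers sigma with -floor((s-1)/2) <= sigma <= floor(s/2), for s >= 1. *)
Definition offsets : seq int :=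
  [seq (t%:Z - (s.-1)./2%:Z)%R | t <- iota 0 s].

Definition cross_adj (u v : prism_vertex n) : bool :=
  [&& u.1 == 0 :> nat, v.1 == 1 :> nat
    & has (fun sigma => (v.2%:Z == u.2%:Z + sigma %[mod n])%Z) offsets].

(* The conjunct u != v removes the loops that j +- 1 = j would give for n = 1. *)
Definition prism : rel (prism_vertex n) := fun u v =>
  (u != v) && [|| cycle_adj u v, cross_adj u v | cross_adj v u].

End Prism.

(* phi(n, s) for n = 4k + r *)
Definition phi (k r s : nat) : nat :=
  match s, r with
  | 1, 0 => k + 2 | 1, 1 => k + 2 | 1, 2 => k + 3 | 1, 3 => k + 2
  | 2, 0 => k + 1 | 2, 1 => k + 2 | 2, 2 => k + 2 | 2, 3 => k + 3
  | 3, 0 => k + 2 | 3, 1 => k + 1 | 3, 2 => k + 2 | 3, 3 => k + 2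
  | _, _ => 0
  end.

From mathcomp Require Import zify.

Lemma mem_offsets s (sigma : int) : 0 < s ->
  (sigma \in offsets s) = (- (s.-1)./2%:Z <= sigma <= s./2%:Z)%R.
Proof.
move=> s_gt0; apply/mapP/idP => [[t] | lesig].
  by rewrite mem_iota => /andP[_ lt_t] ->; lia.
exists `|(sigma + (s.-1)./2%:Z)%R|%N; first by rewrite mem_iota; lia.
by lia.
Qed.

Lemma prism_irrefl n s : irreflexive (@prism n s).
Proof. by move=> u; rewrite /prism eqxx. Qed.

Lemma prism_sym n s : symmetric (@prism n s).
Proof.
have cycleC (u v : prism_vertex n) : cycle_adj u v = cycle_adj v u.
  rewrite /cycle_adj eq_sym orbC; congr (_ && (_ || _)).
    by rewrite -(eqz_modDr 1%R) subrK eq_sym.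
  by rewrite -(eqz_modDr (-1)%R) addrK eq_sym.
move=> u v; rewrite /prism eq_sym [cross_adj s u v || _]orbC.
by rewrite cycleC.
Qed.

(* Main.v *)
Require Import Defs.
From mathcomp Require Import all_boot all_order all_algebra.
From mathcomp Require Import zify.

(** Write D for the diameter and M = n + 3 - s; the distance in the prism is
    explicit, and D is M / 2 rounded down.

    Lower bound.  Three vertices cut the cycle of columns into three arcs.  A
    closed walk through them has length at most n if it stays in one layer; if
    it uses both, it crosses twice, which costs 2 but gains s - 1 columns.  So
    the perimeter of a triple is at most M (lemma [perimeter]); the only
    exception, for s = 3, has two of the three vertices at distance at most 1.
    Adding the radio conditions of a triple u, v, w with increasing labels gives
    3 (D + 1) <= M + 2 (c w - c u), hence c w - c u >= phi; in an exceptional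
    triple c w - c u >= D, and D >= phi if n > 4.  Thus labels two places apart
    in increasing order differ by at least phi, and with 2n vertices the last
    label is at least 1 + (n - 1) phi + 1 (lemma [span_ge]).

    Upper bound.  Equality needs the vertices to come in n consecutive pairs, the
    i-th pair at distance D and labelled 1 + i phi and 2 + i phi.  As
    2 phi >= D + 2, only vertices in the same or in consecutive pairs matter
    (lemma [radio_labeling_of_pairs]).  The pairs are given by columns advancing
    by about n / 4 from one pair to the next, the two columns of a pair being
    about n / 2 apart.  For odd n the advance is coprime to n and all vertices
    are met; for even n the layers, and for n divisible by 4 also the advance,
    are varied where the multiples of a fixed advance would miss some vertices
    ([labeling_odd], [labeling_r2], [labeling_r0], [labeling_r0_s1]).

    The prism with (n, s) = (3, 3) obeys the same formula with k = 0.  For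
    (n, s) = (4, 3) the exceptional triples do occur; there the pairs of
    vertices at distance 2 form two disjoint 4-cycles, so the labels cannot be
    consecutive throughout, and one gap suffices. *)

Set Implicit Arguments.
Unset Strict Implicit.
Unset Printing Implicit Defensive.
Import Order.TTheory GRing.Theory Num.Theory.

(** * Graph distance *)

Section GraphDistance.

Variables (T : finType) (e : rel T) (d : T -> T -> nat).

Hypothesis d_refl : forall u, d u u = 0.
Hypothesis d_edge : forall u v w, e v w -> d u w <= (d u v).+1.
Hypothesis d_descent : forall u v, u != v ->
  exists2 w, e w v & d u v = (d u w).+1.
Hypothesis d_small : forall u v, d u v < #|T|.

(** [d_edge] makes walks at least as long as [d]; [d_descent] produces, backwards
    from v, a walk of exactly that length. *)
Lemma gdist_eq u v : gdist e u v = d u v.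
Proof.
have walk_ge p x : path e x p -> d u (last x p) <= d u x + size p.
  elim: p x => [|y p IHp] x /=; first by rewrite addn0.
  by case/andP=> exy /IHp /leq_trans; apply; rewrite addnS -addSn leq_add2r d_edge.
have walk_d : walk e u v (d u v).
  move def_m: (d u v) => m; elim: m v def_m => [|m IHm] v def_m.
    apply/existsP; exists [tuple] => /=; apply: contraT => u'v.
    by have [w _] := d_descent u'v; rewrite def_m.
  have [|w ewv] := @d_descent u v.
    by apply: contra_eq_neq def_m => ->; rewrite d_refl.
  rewrite def_m => -[/esym/IHm /existsP[p /andP[path_p /eqP last_p]]].
  apply/existsP; exists [tuple of rcons p v].
  by rewrite /= rcons_path path_p last_p ewv last_rcons eqxx.
rewrite /gdist; set s := iota _ _; set P := walk e u v.
have nth_s i : i < #|T| -> nth 0 s i = i by move=> lti; rewrite /s nth_iota.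
have hasP : has P s by apply/hasP; exists (d u v); rewrite // /s mem_iota d_small.
have lt_find : find P s < #|T| by move: hasP; rewrite has_find size_iota.
apply/eqP; rewrite eqn_leq; apply/andP; split.
  rewrite leqNgt; apply/negP => /(before_find 0).
  by rewrite nth_s ?d_small // /P walk_d.
have := nth_find 0 hasP; rewrite nth_s // => /existsP[p /andP[path_p /eqP last_p]].
by have := walk_ge _ _ path_p; rewrite last_p d_refl size_tuple.
Qed.

End GraphDistance.

(** * Radio labelings of arbitrary graphs *)

Section RadioBounds.

Variables (T : finType) (e : rel T).

Lemma leq_span (c : T -> nat) u : c u <= Defs.span c.
Proof. exact: (leq_bigmax u). Qed.

Lemma gdist_le_diam u v : gdist e u v <= diam e.
Proof.
apply: leq_trans (leq_bigmax u); exact: (leq_bigmax v).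
Qed.

Lemma radio_inj c : radio_labeling e c -> injective c.
Proof.
case=> _ c_radio u v eq_c; apply: contraTeq isT => /c_radio.
by rewrite eq_c; have := gdist_le_diam u v; lia.
Qed.

(** By induction on m, in any set of 2m + 2 vertices: remove the two vertices of
    largest labels; the largest one exceeds everything left by at least [phi]. *)
Lemma span_ge (c : T -> nat) (phi m : nat) :
    injective c -> (forall u, 0 < c u) ->
    (forall u v w, c u < c v -> c v < c w -> c u + phi <= c w) ->
  m.+1.*2 <= #|T| -> m * phi + 2 <= Defs.span c.
Proof.
move=> c_inj c_gt0 c_skip; rewrite -cardsT => leT.
suff [v _ /leq_trans->//] : exists2 v, v \in [set: T] & m * phi + 2 <= c v.
  exact: leq_span.
have peel (A : {set T}) N : N < #|A| ->
    exists2 w, w \in A & N <= #|A :\ w| /\ {in A :\ w, forall v, c v < c w}.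
  move=> ltA; have /card_gt0P[a Aa] : 0 < #|A| by apply: leq_ltn_trans ltA.
  case: (@arg_maxnP T a (fun v => v \in A) c Aa) => w /= Aw max_w; exists w => //; split.
    by move: ltA; rewrite (cardsD1 w A) Aw add1n.
  move=> v /setD1P[v'w /max_w]; rewrite leq_eqVlt => /predU1P[/c_inj eq_vw|//].
  by rewrite eq_vw eqxx in v'w.
elim: m [set: T] leT => [|m IHm] A; rewrite doubleS.
  move=> /peel[w Aw [/card_gt0P[v Av] /(_ v Av) lt_vw]].
  by exists w => //; have := c_gt0 v; lia.
move=> /peel[w Aw [/peel[v Av [leA lt_v]] lt_w]].
have [u Au le_u] := IHm _ leA; exists w => //.
have := c_skip u v w (lt_v u Au) (lt_w v Av); lia.
Qed.

(** The vertices [x i false] and [x i true] get the labels 1 + i phi and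
    2 + i phi.  Labels of pairs i and j >= i + 2 differ by at least
    2 phi - 1 > D, so the radio condition is only at stake inside a pair and
    between consecutive pairs. *)
Lemma radio_labeling_of_pairs (n phi : nat) (x : 'I_n -> bool -> T) :
    (forall u v, gdist e u v = gdist e v u) ->
    0 < n -> #|T| = n.*2 -> diam e + 2 <= phi.*2 ->
    (forall i j b b', x i b = x j b' -> i = j /\ b = b') ->
    (forall i, diam e <= gdist e (x i false) (x i true)) ->
    (forall (i j : 'I_n) (b b' : bool), j = i.+1 :> nat ->
      diam e + 1 + b <= gdist e (x i b) (x j b') + phi + b') ->
  exists2 c, radio_labeling e c & Defs.span c = (n - 1) * phi + 2.
Proof.
move=> gdistC n_gt0 cardT le_phi x_inj x_pair x_step.
pose f (t : 'I_n * bool) := x t.1 t.2.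
have f_inj : injective f by move=> [i b] [j b'] /x_inj[/= -> ->].
have /(inj_card_bij f_inj)[g fK gK] : #|T| <= #|{: 'I_n * bool}|.
  by rewrite card_prod card_ord card_bool cardT muln2.
pose lab (t : 'I_n * bool) := (t.1 * phi + t.2).+1.
have lab_radio (s t : 'I_n * bool) : s != t -> s.1 <= t.1 ->
    diam e + 1 <= gdist e (f s) (f t) + `|lab s - lab t|%N.
  case: s t => [i b] [j b'] /= nst le_ij; rewrite /f /lab /=.
  have [eq_ij|lt_ij] := eqVneq i j.
    rewrite -{}eq_ij in nst *; have := x_pair i.
    move: nst; rewrite -pair_eqE /= eqxx /=.
    by case: b; case: b' => //= _; rewrite 1?gdistC; lia.
  have {}lt_ij : i < j by rewrite ltn_neqAle le_ij -val_eqE in lt_ij *; rewrite lt_ij.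
  have [eq_j|ne_j] := eqVneq (j : nat) i.+1.
    by have := x_step i j b b' eq_j; rewrite eq_j; lia.
  have [m def_j] : exists m, j = i.+2 + m :> nat by exists (j - i.+2); lia.
  (* i and j are at least two pairs apart: the labels alone suffice. *)
  rewrite def_j !mulnDl; lia.
exists (fun v => lab (g v)).
  split=> // u v nuv; have ng : g u != g v by rewrite (can_eq gK).
  have [le_uv|/ltnW le_vu] := leqP (g u).1 (g v).1.
    by have := lab_radio _ _ ng le_uv; rewrite !gK.
  by rewrite eq_sym in ng; have := lab_radio _ _ ng le_vu; rewrite !gK gdistC; lia.
apply/eqP; rewrite eqn_leq; apply/andP; split.
  apply/bigmax_leqP => u _; case: (g u) => i b; rewrite /lab /=.
  have : i * phi <= (n - 1) * phi by rewrite leq_mul2r; have := ltn_ord i; lia.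
  lia.
have lt_n : n - 1 < n by lia.
apply: leq_trans (leq_span _ (f (Ordinal lt_n, true))).
by rewrite fK /lab /=; lia.
Qed.

End RadioBounds.

(** * Distance in a cycle *)

Section CyclicNorm.

Variable n : nat.
Hypothesis n_gt0 : 0 < n.
Implicit Types x y z : int.

(** The distance from x to the nearest multiple of n, which is the distance in the
    n-cycle between two columns that differ by x. *)
Definition cyc x : nat := minn `|(x %% n)%Z| `|(n%:Z - (x %% n)%Z)%R|.

Lemma cyc_le x z : cyc x <= `|(x - z * n%:Z)%R|.
Proof.
rewrite /cyc; have := divz_eq x n.
have n_neq0 : (n%:Z != 0)%R by lia.
have := modz_ge0 x n_neq0; have := ltz_mod x n_neq0.
move: (x %/ n)%Z (x %% n)%Z => q r lt_r r_ge0 def_x.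
have [le_zq|lt_qz] := lerP z q.
  have : (0 <= (q - z) * n%:Z)%R by rewrite mulr_ge0; lia.
  lia.
have : (0 <= (z - q - 1) * n%:Z)%R by rewrite mulr_ge0; lia.
lia.
Qed.

Lemma cycP x : exists z, cyc x = `|(x - z * n%:Z)%R|.
Proof.
rewrite /cyc; have := divz_eq x n; set q := (x %/ n)%Z; set r := (x %% n)%Z => def_x.
have [_|_] := leqP; [exists q | exists (q + 1)%R]; rewrite [in RHS]def_x; lia.
Qed.

Lemma cyc_eq_mod x y : (x = y %[mod n])%Z -> cyc x = cyc y.
Proof. by rewrite /cyc => ->. Qed.

Lemma cycN x : cyc (- x)%R = cyc x.
Proof.
apply/eqP; rewrite eqn_leq; apply/andP; split.
  by have [z ->] := cycP x; have := cyc_le (- x)%R (- z)%R; lia.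
by have [z ->] := cycP (- x)%R; have := cyc_le x (- z)%R; lia.
Qed.

Lemma cyc0 : cyc 0%R = 0.
Proof. by have := cyc_le 0 0; lia. Qed.

Lemma cycS x : cyc (x + 1)%R <= (cyc x).+1.
Proof. have [z ->] := cycP x; have := cyc_le (x + 1)%R z; lia. Qed.

Lemma cycB x : cyc (x - 1)%R <= (cyc x).+1.
Proof. have [z ->] := cycP x; have := cyc_le (x - 1)%R z; lia. Qed.

Lemma cyc_descent x : 0 < cyc x ->
  cyc x = (cyc (x - 1)%R).+1 \/ cyc x = (cyc (x + 1)%R).+1.
Proof.
have [z def_x] := cycP x => x_gt0.
have := cycS (x - 1)%R; have := cycB (x + 1)%R.
have := cyc_le (x - 1)%R z; have := cyc_le (x + 1)%R z.
rewrite subrK addrK; lia.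
Qed.

Lemma cyc_eq0 x : cyc x = 0 -> (x = 0 %[mod n])%Z.
Proof.
have [z ->] := cycP x => /eqP; rewrite absz_eq0 subr_eq0 => /eqP ->.
by rewrite modzMl mod0z.
Qed.

Lemma cyc_ge (m : nat) x z :
  (z * n%:Z + m%:Z <= x)%R -> (x <= (z + 1) * n%:Z - m%:Z)%R -> m <= cyc x.
Proof.
have [w ->] := cycP x => le_x ge_x.
have [le_wz|lt_zw] := lerP w z.
  have : (0 <= (z - w) * n%:Z)%R by rewrite mulr_ge0; lia.
  lia.
have : (0 <= (w - z - 1) * n%:Z)%R by rewrite mulr_ge0; lia.
lia.
Qed.

End CyclicNorm.

(** * The distance formula *)

Section Separation.

Variables n s : nat.
Hypotheses (n_gt0 : 0 < n) (s_bound : 0 < s <= 3).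
Implicit Types (x y sigma : int) (l : bool).

(** A shortest walk from layer 0 to layer 1 that advances by x columns crosses
    once, along the rung whose offset leaves the shortest way along the cycle. *)
Definition cross_sep x : nat :=
  (foldr minn (cyc n x) [seq cyc n (x - sigma)%R | sigma <- offsets s]).+1.

(** The distance from layer l to layer l' at a column difference x; offsets are
    seen with the opposite sign when crossing from layer 1. *)
Definition sep l l' x : nat :=
  if l == l' then cyc n x else cross_sep (if l then (- x)%R else x).

Lemma offsets_diff sigma tau :
  sigma \in offsets s -> tau \in offsets s -> `|(sigma - tau)%R| <= 2.
Proof.
have : s.-1./2 + s./2 <= 2 by lia.
rewrite !mem_offsets; lia.
Qed.

Lemma cross_sep_le x sigma :
  sigma \in offsets s -> cross_sep x <= (cyc n (x - sigma)%R).+1.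
Proof.
rewrite /cross_sep ltnS; elim: (offsets s) => //= t S IHS.
rewrite inE => /predU1P[->|/IHS]; rewrite geq_min ?leqnn //.
by move=> ->; rewrite orbT.
Qed.

Lemma cross_sepP x :
  exists2 sigma : int, sigma \in offsets s & cross_sep x = (cyc n (x - sigma)%R).+1.
Proof.
have: 0%R \in offsets s by rewrite mem_offsets; lia.
rewrite /cross_sep => s0.
suff: cyc n x = foldr minn (cyc n x) [seq cyc n (x - sigma)%R | sigma <- offsets s] \/
    exists2 sigma : int, sigma \in offsets s &
    foldr minn (cyc n x) [seq cyc n (x - sigma)%R | sigma <- offsets s] =
      cyc n (x - sigma)%R.
  by move=> [<-|[sigma ? ->]]; [exists 0%R; rewrite ?subr0 | exists sigma].
elim: (offsets s) => [|t S IHS] /=; first by left.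
have [le_t|lt_t] := leqP (cyc n (x - t)%R) (foldr minn _ _).
  by right; exists t; rewrite ?mem_head.
case: IHS => [|[sigma S_sigma ->]]; first by left.
by right; exists sigma; rewrite // inE S_sigma orbT.
Qed.

Lemma sep_eq_mod l l' x y : (x = y %[mod n])%Z -> sep l l' x = sep l l' y.
Proof.
have cross_eq_mod u v : (u = v %[mod n])%Z -> cross_sep u = cross_sep v.
  move=> equv; rewrite /cross_sep (cyc_eq_mod equv); congr (foldr _ _ _).+1.
  by apply: eq_map => z; apply: cyc_eq_mod; rewrite -modzDml equv modzDml.
move=> eqxy; rewrite /sep; case: ifP => _; first exact: cyc_eq_mod.
apply: cross_eq_mod; case: l => //.
by rewrite -modzNm eqxy modzNm.
Qed.

Lemma sepC l l' x : sep l' l (- x)%R = sep l l' x.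
Proof. by rewrite /sep; case: l; case: l' => //=; rewrite ?cycN ?opprK. Qed.

Lemma cross_sepS x : cross_sep (x + 1)%R <= (cross_sep x).+1.
Proof.
have [sigma ? ->] := cross_sepP x.
apply: leq_trans (cross_sep_le _ _) _; first by eassumption.
by have := cycS n_gt0 (x - sigma)%R; rewrite addrAC.
Qed.

Lemma cross_sepB x : cross_sep (x - 1)%R <= (cross_sep x).+1.
Proof.
have [sigma ? ->] := cross_sepP x.
apply: leq_trans (cross_sep_le _ _) _; first by eassumption.
by have := cycB n_gt0 (x - sigma)%R; rewrite addrAC.
Qed.

Lemma sepS l l' x : sep l l' (x + 1)%R <= (sep l l' x).+1.
Proof.
rewrite /sep; case: ifP => _; first exact: cycS.
by case: l; rewrite ?opprD ?cross_sepS ?cross_sepB.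
Qed.

Lemma sepB l l' x : sep l l' (x - 1)%R <= (sep l l' x).+1.
Proof. by rewrite -sepC -[in leqRHS]sepC opprB addrC sepS. Qed.

(** The nontrivial case is a walk that crosses twice: it moves by the difference of
    two offsets, which is at most 2 as s <= 3, so it is no shorter than the walk
    along the cycle.  This is where the distance formula needs s <= 3. *)
Lemma sep_cross l sigma x : sigma \in offsets s ->
  sep l true (x + sigma)%R <= (sep l false x).+1.
Proof.
move=> os; case: l; rewrite /sep /=.
  have [tau ot ->] := cross_sepP (- x)%R; rewrite -[cyc _ (- x - tau)%R]cycN // opprB opprK.
  have [z ->] := cycP n_gt0 (tau + x)%R; have := cyc_le n_gt0 (x + sigma)%R z.
  by have := offsets_diff os ot; lia.
by rewrite (leq_trans (cross_sep_le _ os)) // addrK.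
Qed.

Lemma sep_flip l l' x : sep (~~ l) (~~ l') (- x)%R = sep l l' x.
Proof. by rewrite /sep; case: l; case: l' => /=; rewrite ?cycN ?opprK. Qed.

Lemma sep_uncross l sigma x : sigma \in offsets s ->
  sep l false x <= (sep l true (x + sigma)%R).+1.
Proof.
move=> os; rewrite -sep_flip -[in leqRHS]sep_flip opprD.
by have := sep_cross (~~ l) (- x - sigma)%R os; rewrite subrK.
Qed.

Lemma sep_descent l l' x : 1 < sep l l' x \/ l = l' /\ 0 < sep l l' x ->
  sep l l' x = (sep l l' (x - 1)%R).+1 \/ sep l l' x = (sep l l' (x + 1)%R).+1.
Proof.
have cross_descent y : 1 < cross_sep y ->
  cross_sep y = (cross_sep (y - 1)%R).+1 \/ cross_sep y = (cross_sep (y + 1)%R).+1.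
  have [sigma os def_y] := cross_sepP y; rewrite def_y ltnS => y_gt0.
  have := cross_sepS (y - 1)%R; have := cross_sepB (y + 1)%R.
  have := cross_sep_le (y - 1)%R os; have := cross_sep_le (y + 1)%R os.
  rewrite subrK addrK def_y [(y + 1 - sigma)%R]addrAC [(y - 1 - sigma)%R]addrAC.
  case: (cyc_descent n_gt0 y_gt0) => {def_y y_gt0}.
    by move: (cyc _ _) (cyc _ _) (cyc _ _) (cross_sep _) (cross_sep _); lia.
  by move: (cyc _ _) (cyc _ _) (cyc _ _) (cross_sep _) (cross_sep _); lia.
rewrite /sep; case: eqP => [_ | _ [lt1|[//]]].
  by move=> x_gt0; apply: cyc_descent => //; case: x_gt0 => [|[]]; lia.
case: l lt1 => /cross_descent //=.
by rewrite !opprD opprK => -[]; [right | left].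
Qed.

End Separation.

(** * Distance in the prism *)

Section PrismVertex.

Variable n : nat.
Hypothesis n_gt0 : 0 < n.
Implicit Types (x : int) (l : bool) (u v : prism_vertex n).

Definition side u : bool := u.1 == 1 :> nat.

Fact vtx_proof x : `|(x %% n)%Z| < n.
Proof. have := modz_ge0 x (d := n); have := ltz_pmod x (d := n); lia. Qed.

Definition vtx l x : prism_vertex n := (inord l, Ordinal (vtx_proof x)).

Lemma side_vtx l x : side (vtx l x) = l.
Proof. by rewrite /side /= inordK; case: l. Qed.

Lemma pos_vtx l x : ((vtx l x).2 : int) = (x %% n)%Z.
Proof. by rewrite /= gez0_abs // modz_ge0; lia. Qed.

Lemma pos_mod u : ((u.2 : int) %% n)%Z = u.2.
Proof. by rewrite modz_small //; have := ltn_ord u.2; lia. Qed.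

Lemma vertexP u v : side u = side v -> (u.2 = v.2 %[mod n])%Z -> u = v.
Proof.
rewrite !pos_mod; case: u v => [[i lti] j] [[i' lti'] j'].
rewrite /side /= => eq_side [eq_j]; congr pair; apply: val_inj => //=.
by move: lti lti' eq_side; case: i => [|[]]; case: i' => [|[]].
Qed.

End PrismVertex.

Section PrismDistance.

Variables n s : nat.
Hypotheses (s_bound : 0 < s <= 3) (le_sn : s <= n).
Implicit Types (x y sigma : int) (l : bool) (u v w : prism_vertex n).

Let n_gt0 : 0 < n. Proof. lia. Qed.

Definition pdist u v : nat := sep n s (side u) (side v) (v.2%:Z - u.2%:Z)%R.

Lemma pdist_eq u v x :
  (x = v.2%:Z - u.2%:Z %[mod n])%Z -> pdist u v = sep n s (side u) (side v) x.
Proof. by move=> eqx; apply: sep_eq_mod => //; rewrite -eqx. Qed.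

Lemma pdist_vtx (n_pos : 0 < n) l l' x y :
  pdist (vtx n_pos l x) (vtx n_pos l' y) = sep n s l l' (y - x)%R.
Proof.
rewrite (@pdist_eq _ _ (y - x)%R) ?side_vtx // !pos_vtx.
by rewrite modzDml -[RHS]modzDmr modzNm modzDmr.
Qed.

Lemma pdistC u v : pdist u v = pdist v u.
Proof. by rewrite /pdist -sepC // opprB. Qed.

Lemma pdist_refl u : pdist u u = 0.
Proof. by rewrite /pdist /sep eqxx subrr cyc0. Qed.

Lemma cycle_adjP u v : cycle_adj u v ->
  side u = side v /\
  ((v.2 = u.2%:Z + 1 %[mod n])%Z \/ (v.2 = u.2%:Z - 1 %[mod n])%Z).
Proof.
by rewrite /cycle_adj /side => /andP[/eqP-> /orP[]/eqP]; split; [|left| |right].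
Qed.

Lemma cross_adjP u v : cross_adj s u v ->
  [/\ side u = false, side v = true
    & exists2 sigma : int, sigma \in offsets s & (v.2 = u.2%:Z + sigma %[mod n])%Z].
Proof.
rewrite /cross_adj /side => /and3P[/eqP-> /eqP-> /hasP[sigma os /eqP eqv]].
by split=> //; exists sigma.
Qed.

Lemma pdist_edge u v w : prism s v w -> pdist u w <= (pdist u v).+1.
Proof.
have shift x : (w.2 = v.2%:Z + x %[mod n])%Z ->
    pdist u w = sep n s (side u) (side w) (v.2%:Z - u.2%:Z + x)%R.
  by move=> eqw; apply: pdist_eq; rewrite -[RHS]modzDml eqw modzDml addrAC.
case/andP=> _ /or3P[/cycle_adjP[eq_side []]/shift->|/cross_adjP|/cross_adjP].
- by rewrite -eq_side sepS.
- by rewrite -eq_side sepB.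
- case=> side_v side_w [sigma os /shift->].
  by rewrite /pdist side_v side_w sep_cross.
case=> side_w side_v [sigma os eqv].
rewrite (@pdist_eq u v (w.2%:Z - u.2%:Z + sigma)%R).
  by rewrite /pdist side_v side_w sep_uncross.
by rewrite -[RHS]modzDml eqv modzDml addrAC.
Qed.

Lemma pdist_eq0 u v : pdist u v = 0 -> u = v.
Proof.
rewrite /pdist /sep; case: eqP => // eq_side /(cyc_eq0 n_gt0)/eqP.
by rewrite mod0z => /eqP/dvdz_mod0P; rewrite -eqz_mod_dvd => /eqP/esym/vertexP; apply.
Qed.

Lemma prism_cycle u v x : u != v -> side u = side v -> x = 1%R \/ x = (-1)%R ->
  (v.2 = u.2%:Z + x %[mod n])%Z -> prism s u v.
Proof.
move=> nuv eq_side x1 eqv; rewrite /prism nuv /=; apply/orP; left.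
apply/andP; split.
  apply/eqP/ord_inj; move: eq_side (ltn_ord u.1) (ltn_ord v.1); rewrite /side; lia.
by case: x1 eqv => -> ->; rewrite eqxx ?orbT.
Qed.

Lemma prism_cross u v sigma : side u = false -> side v = true ->
  sigma \in offsets s -> (v.2 = u.2%:Z + sigma %[mod n])%Z -> prism s u v.
Proof.
move=> side_u side_v os eqv; apply/andP; split.
  by apply: contraFneq side_u => ->.
apply/orP; right; apply/orP; left; apply/and3P; split.
- by move: side_u (ltn_ord u.1); rewrite /side; lia.
- exact: side_v.
by apply/hasP; exists sigma => //; apply/eqP.
Qed.

(** Either one can step along the cycle towards u, or u and v are joined by a
    rung. *)
Lemma pdist_descent u v : u != v -> exists2 w, prism s w v & pdist u v = (pdist u w).+1.
Proof.
move=> nuv; have uv_gt0 : 0 < pdist u v.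
  by rewrite lt0n; apply: contra nuv => /eqP/pdist_eq0/eqP.
have pdist_shift x : pdist u (vtx n_gt0 (side v) (v.2%:Z + x)%R) =
    sep n s (side u) (side v) (v.2%:Z - u.2%:Z + x)%R.
  by rewrite (@pdist_eq _ _ (v.2%:Z - u.2%:Z + x)%R) ?side_vtx // pos_vtx modzDml addrAC.
have descent x : x = 1%R \/ x = (-1)%R ->
    pdist u v = (sep n s (side u) (side v) (v.2%:Z - u.2%:Z + x)%R).+1 ->
    exists2 w, prism s w v & pdist u v = (pdist u w).+1.
  move=> x1; rewrite -pdist_shift => duv.
  exists (vtx n_gt0 (side v) (v.2%:Z + x)%R) => //.
  apply: (@prism_cycle _ _ (- x)%R); rewrite ?side_vtx //.
  - by apply: contra_eqN duv => /eqP->; lia.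
  - by case: x1 => ->; [right | left].
  - by rewrite pos_vtx modzDml addrK.
have [step|] : (1 < pdist u v \/ side u = side v /\ 0 < pdist u v) \/
    side u != side v /\ pdist u v = 1.
  case: (eqVneq (side u) (side v)) => [eq_side|]; first by left; right.
  by case: (ltngtP 1 (pdist u v)); [left; left | lia | right].
  by case: (sep_descent n_gt0 s_bound step); apply: descent; [right | left].
case=> side_uv duv; exists u; last by rewrite pdist_refl.
move: duv; rewrite /pdist /sep (negPf side_uv).
have [sigma os ->] := cross_sepP n_gt0 s_bound
  (if side u then - (v.2%:Z - u.2%:Z) else v.2%:Z - u.2%:Z)%R.
case=> /(cyc_eq0 n_gt0); case: ifP => side_u eq0.
  rewrite prism_sym; apply: (prism_cross _ _ os) => //.
    by move: side_uv; rewrite side_u; case: (side v).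
  apply/eqP; rewrite eqz_mod_dvd; apply/dvdz_mod0P.
  by rewrite -[RHS](mod0z n) -eq0 opprB opprD addrA.
apply: (prism_cross _ _ os) => //.
  by move: side_uv; rewrite side_u; case: (side v).
apply/eqP; rewrite eqz_mod_dvd; apply/dvdz_mod0P.
by rewrite -[RHS](mod0z n) -eq0 opprD addrA.
Qed.

Lemma card_prism : #|{: prism_vertex n}| = n.*2.
Proof. by rewrite card_prod !card_ord mul2n. Qed.

(** The number of columns that a rung can gain in the positive direction on the way
    from layer l to layer l'. *)
Definition turn l l' : nat :=
  if l == l' then 0 else if l then s.-1./2 else s./2.

(** Advance along the arc of a columns, using the most favourable rung that does not
    overshoot: when a is less than [turn l l'] a rung reaches the target column at
    once, which the truncated subtraction accounts for. *)
Lemma sep_le_arc l l' (a : nat) : sep n s l l' a <= (l != l') + (a - turn l l').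
Proof.
rewrite /sep /turn; case: eqP => [_|_] /=.
  by have := cyc_le n_gt0 a 0; lia.
pose t : nat := minn a (if l then s.-1./2 else s./2).
have ot : (if l then - t%:Z else t%:Z)%R \in offsets s.
  by rewrite mem_offsets /t; case: (l); lia.
apply: leq_trans (cross_sep_le _ _ ot) _; rewrite add1n ltnS.
by apply: leq_trans (cyc_le n_gt0 _ 0) _; rewrite /t; case: (l); lia.
Qed.

(** The matching lower bound, for x in the z-th period: x has to be far enough from
    both z n and (z + 1) n. *)
Lemma sep_ge_arc l l' x z (m : nat) :
    (z * n%:Z + (m%:Z - (l != l')%:Z + (turn l l')%:Z) <= x)%R ->
    (x <= (z + 1) * n%:Z - (m%:Z - (l != l')%:Z + (turn l' l)%:Z))%R ->
  m <= sep n s l l' x.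
Proof.
case: m => // m; rewrite /sep /turn [l' == l]eq_sym.
case: eqP => [_|/eqP neq_ll'] /= le_x ge_x; first by apply: (cyc_ge n_gt0 (z := z)); lia.
case: l l' neq_ll' le_x ge_x => -[] //= _ le_x ge_x.
  have [sigma os ->] := cross_sepP n_gt0 s_bound (- x)%R.
  rewrite ltnS -cycN //; apply: (cyc_ge n_gt0 (z := z)).
    by move: os; rewrite mem_offsets; lia.
  by move: os; rewrite mem_offsets; lia.
have [sigma os ->] := cross_sepP n_gt0 s_bound x.
rewrite ltnS; apply: (cyc_ge n_gt0 (z := z)).
  by move: os; rewrite mem_offsets; lia.
by move: os; rewrite mem_offsets; lia.
Qed.

Lemma pdist_le u v (l := side u) (l' := side v) : u.2 <= v.2 ->
  pdist u v <= (l != l') + minn (v.2 - u.2 - turn l l') (n - (v.2 - u.2) - turn l' l).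
Proof.
move=> le_uv; rewrite addn_minr leq_min; apply/andP; split.
  rewrite (@pdist_eq _ _ (v.2 - u.2)%N) ?sep_le_arc //.
  by rewrite -subzn.
rewrite pdistC eq_sym (@pdist_eq _ _ (n - (v.2 - u.2))%N) ?sep_le_arc //.
by rewrite -!subzn ?modzDl ?opprB //; have := ltn_ord v.2; lia.
Qed.

Lemma pdist_le_half u v : pdist u v <= (n + 3 - s)./2.
Proof.
wlog le_uv : u v / u.2 <= v.2.
  by move=> IH; case/orP: (leq_total u.2 v.2) => /IH; rewrite // pdistC.
apply: leq_trans (pdist_le le_uv) _.
have := ltn_ord v.2; rewrite /turn.
by case: (side u); case: (side v) => /=; lia.
Qed.

(** The arcs p, q, r between the three columns in cyclic order add up to n.  Going
    around once, a layer change is made either never or once in each direction;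
    two changes cost 2 and gain s - 1 columns in all, unless an arc is too short
    for the gain.  Then the other way around is short enough, except that for
    s = 3 the triple may contain a rung. *)
Lemma perimeter u v w (P := pdist u v + pdist v w + pdist u w) :
  P <= n + 3 - s \/ s = 3 /\ (pdist u v <= 1 \/ pdist v w <= 1 \/ pdist u w <= 1).
Proof.
pose Q (x y z : prism_vertex n) := pdist x y + pdist y z + pdist x z <= n + 3 - s \/
  s = 3 /\ (pdist x y <= 1 \/ pdist y z <= 1 \/ pdist x z <= 1).
have swap12 (x y z : prism_vertex n) : Q x y z -> Q y x z.
  rewrite /Q [pdist y x]pdistC; move: (pdist _ _) (pdist _ _) (pdist _ _); lia.
have swap23 (x y z : prism_vertex n) : Q x y z -> Q x z y.
  rewrite /Q [pdist z y]pdistC; move: (pdist _ _) (pdist _ _) (pdist _ _); lia.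
suff sorted (x y z : prism_vertex n) : x.2 <= y.2 -> y.2 <= z.2 -> Q x y z.
  rewrite -/(Q u v w); case/orP: (leq_total u.2 v.2) => uv;
    case/orP: (leq_total v.2 w.2) => vw; case/orP: (leq_total u.2 w.2) => uw.
  - exact: sorted.
  - exact: sorted.
  - exact/swap23/sorted.
  - exact/swap23/swap12/sorted.
  - exact/swap12/sorted.
  - exact/swap12/swap23/sorted.
  - exact/swap12/swap23/swap12/sorted.
  - exact/swap12/swap23/swap12/sorted.
rewrite /Q => le_xy le_yz; have le_xz := leq_trans le_xy le_yz.
have := pdist_le le_xy; have := pdist_le le_yz; have := pdist_le le_xz.
pose p := y.2 - x.2; pose q := z.2 - y.2; pose r := n - (p + q).
have lt_z := ltn_ord z.2.
have -> : y.2 - x.2 = p by []. have -> : z.2 - y.2 = q by [].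
have -> : z.2 - x.2 = p + q by rewrite /p /q; lia.
have def_n : n = p + q + r by rewrite /r /p /q; lia.
have -> : n - p = q + r by lia. have -> : n - q = r + p by lia.
have -> : n - (p + q) = r by lia.
move: (side x) (side y) (side z) => lx ly lz.
have := le_sn; rewrite def_n; rewrite !addn_minr !leq_min /turn.
move: p q r (pdist x y) (pdist y z) (pdist x z) {le_xy le_yz le_xz lt_z def_n}.
have [|[]] : s = 1 \/ s = 2 \/ s = 3 by lia.
all: move=> ->; case: lx; case: ly; case: lz; rewrite /=; clear => p q r d12 d23 d13; lia.
Qed.

Lemma gdist_prism u v : gdist (@prism n s) u v = pdist u v.
Proof.
apply: gdist_eq.
- exact: pdist_refl.
- exact: pdist_edge.
- exact: pdist_descent.
by move=> x y; rewrite card_prism; have := pdist_le_half x y; lia.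
Qed.

(** The diameter is attained from layer 0 to layer 1, half-way around. *)
Lemma sep_uphalf : (n + 3 - s)./2 <= sep n s false true (uphalf n).
Proof.
have [|[]] : s = 1 \/ s = 2 \/ s = 3 by lia.
all: by move=> eq_s; apply: (sep_ge_arc (z := 0%R)); move: le_sn; rewrite /turn eq_s /=; lia.
Qed.

Lemma diam_prism : diam (@prism n s) = (n + 3 - s)./2.
Proof.
apply/eqP; rewrite eqn_leq; apply/andP; split.
  do 2!apply/bigmax_leqP => ? _; rewrite gdist_prism; exact: pdist_le_half.
have := gdist_le_diam (@prism n s) (vtx n_gt0 false 0) (vtx n_gt0 true (uphalf n)).
by rewrite gdist_prism pdist_vtx subr0; apply: leq_trans sep_uphalf.
Qed.

(** The second case is that of an exceptional triple: two vertices at distance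
    at most 1 have labels at least D apart. *)
Lemma radio_skip (D := (n + 3 - s)./2) c u v w :
    radio_labeling (@prism n s) c -> c u < c v -> c v < c w ->
  3 * D.+1 <= n + 3 - s + 2 * (c w - c u) \/ s = 3 /\ D <= c w - c u.
Proof.
case=> _; rewrite diam_prism -/D => c_radio lt_uv lt_vw.
have far (x y : prism_vertex n) : c x < c y -> D + 1 <= pdist x y + (c y - c x).
  move=> lt_xy; have := c_radio x y; rewrite gdist_prism distnEr ?(ltnW lt_xy) //.
  by apply; apply: contraTneq lt_xy => ->; rewrite ltnn.
have := far _ _ lt_uv; have := far _ _ lt_vw; have := far _ _ (ltn_trans lt_uv lt_vw).
have := perimeter u v w; move: (pdist u v) (pdist v w) (pdist u w) => d12 d23 d13.
case=> [le_P | [eq_s small]] far13 far23 far12; [left | right]; lia.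
Qed.

End PrismDistance.

(** * Lower bound for the span, and labelings by antipodal pairs *)

Section PrismRadio.

Variables n s : nat.
Hypotheses (s_bound : 0 < s <= 3) (le_sn : s <= n).

Notation D := (n + 3 - s)./2.

(** The 2 in [maxn 2 D] is the least gap over two labels in any case; it is what
    the complete graph n = s = 3, with D = 1, needs. *)
Lemma prism_span_ge phi c : radio_labeling (@prism n s) c ->
    n + 3 - s + phi.*2 <= 3 * D.+1 + 1 -> (s = 3 -> phi <= maxn 2 D) ->
  (n - 1) * phi + 2 <= Defs.span c.
Proof.
move=> c_radio le_phi le_phi3; apply: (@span_ge _ _ phi).
- exact: radio_inj c_radio.
- by case: c_radio.
- move=> u v w lt_uv lt_vw.
  have := radio_skip s_bound le_sn c_radio lt_uv lt_vw.
  by case=> [le_gap | [/le_phi3]]; lia.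
by rewrite card_prism; lia.
Qed.

(** The numbers [p i b] are columns before reduction modulo n, so that the column
    differences between consecutive pairs are explicit, whatever wraps around. *)
Lemma prism_labeling phi (l : nat -> bool -> bool) (p : nat -> bool -> nat) :
    D + 2 <= phi.*2 ->
    (forall i j b b' (w : int), i < n -> j < n -> l i b = l j b' ->
      ((p i b)%:Z = (p j b')%:Z + w * n%:Z)%R -> i = j /\ b = b') ->
    (forall i, D <= sep n s (l i false) (l i true) ((p i true)%:Z - (p i false)%:Z)%R) ->
    (forall i (b b' : bool), D + 1 + b - (phi + b') <=
      sep n s (l i b) (l i.+1 b') ((p i.+1 b')%:Z - (p i b)%:Z)%R) ->
  exists2 c, radio_labeling (@prism n s) c & Defs.span c = (n - 1) * phi + 2.
Proof.
move=> le_phi p_inj p_pair p_step.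
have n_gt0 : 0 < n by lia.
apply: (@radio_labeling_of_pairs _ _ n phi
  (fun i b => vtx n_gt0 (l i b) (p i b))) => //.
- by move=> u v; rewrite !gdist_prism // pdistC.
- exact: card_prism.
- by rewrite diam_prism // addn2 in le_phi *.
- move=> i j b b' eq_v.
  have eq_l : l i b = l j b' by rewrite -[LHS](side_vtx n_gt0 _ (p i b)) eq_v side_vtx.
  have : (p i b = p j b' %[mod n])%Z by rewrite -!(pos_vtx n_gt0 (l i b)) eq_v eq_l.
  move/eqP; rewrite eqz_mod_dvd => /dvdzP[w def_w].
  have [|||/val_inj] // := p_inj i j b b' w _ _ eq_l.
  by rewrite -def_w addrC subrK.
- by move=> i; rewrite diam_prism // gdist_prism // pdist_vtx.
move=> i j b b' ->; rewrite diam_prism // gdist_prism // pdist_vtx.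
by have := p_step i b b'; rewrite leq_subLR [phi + _ + _]addnC addnA.
Qed.

End PrismRadio.

(** * The labelings *)

Lemma dvdz_small (n : nat) (x y : int) : x = (y * n)%R -> `|x| < n -> x = 0%R.
Proof.
move=> ->; case: (eqVneq y 0%R) => [->|y_neq0]; first by rewrite mul0r.
by move=> lt_n; rewrite ltnNge abszM leq_pmull ?absz_gt0 in lt_n.
Qed.

Section Labelings.

Variables n k r s : nat.
Hypotheses (s_bound : 0 < s <= 3) (def_n : n = 4 * k + r).

Let s123 : s = 1 \/ s = 2 \/ s = 3. Proof. lia. Qed.

(** The pairs advance by t = k or k + 1 and each goes from layer 0 to layer 1.
    Since 4t = n - 1 or n + 1, t is invertible modulo n. *)
Lemma labeling_odd : r = 1 \/ r = 3 -> 0 < k \/ n = 3 /\ s = 3 ->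
  exists2 c, radio_labeling (@prism n s) c & Defs.span c = (n - 1) * phi k r s + 2.
Proof.
move=> odd_r k_gt0.
have le_sn : s <= n by lia.
pose t := k + r./2; pose h := 2 * k + 1 + r./2.
apply: (prism_labeling s_bound le_sn (l := fun _ b => b) (p := fun i b => t * i + b * h)).
- case: s123 k_gt0 => [|[]] ->; case: odd_r def_n => -> eq_n; rewrite /=; lia.
- move=> i j b b' w lt_i lt_j /= <- eq_ij; split=> //.
  have {}eq_ij : (t%:Z * (i%:Z - j%:Z) = w * n%:Z)%R by lia.
  (* Multiply by 4: 4 t is congruent to -1 or 1 modulo n. *)
  have [z eq_z] : exists z : int, (i%:Z - j%:Z = z * n%:Z)%R.
    move: eq_ij; rewrite {}/t {}/h def_n; case: odd_r => -> /= eq_ij.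
      exists (i%:Z - j%:Z - 4 * w)%R; lia.
    exists (4 * w - i%:Z + j%:Z)%R; lia.
  by have := dvdz_small eq_z; lia.
- move=> i; apply: (sep_ge_arc s_bound le_sn (z := 0%R)); rewrite /turn /t /h /=;
    case: s123 k_gt0 => [|[]] ->; case: odd_r def_n => -> eq_n; rewrite /=; lia.
move=> i b b'; rewrite mulnS.
(* The column difference is negative exactly on the way from the second vertex of
   a pair to the first vertex of the next one. *)
apply: (sep_ge_arc s_bound le_sn
    (z := if b && ~~ b' then (-1)%R else 0%R)); rewrite /turn /t /h;
  case: s123 k_gt0 => [|[]] ->; case: odd_r def_n => -> eq_n;
  by case: b; case: b' => /= ?; lia.
Qed.

(** The pairs advance by k.  If k is odd, it is coprime to n = 2 (2k + 1).  If k is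
    even, its multiples are the even columns only and each is met twice; going
    through the pair in alternating directions separates the two visits. *)
Lemma labeling_r2 : r = 2 -> 0 < k ->
  exists2 c, radio_labeling (@prism n s) c & Defs.span c = (n - 1) * phi k r s + 2.
Proof.
move=> r2 k_gt0; have le_sn : s <= n by lia.
pose h := 2 * k + 1.
apply: (prism_labeling s_bound le_sn
  (l := fun i b => (odd i && ~~ odd k) (+) b) (p := fun i b => k * i + b * h)).
- rewrite r2; case: s123 => [|[]] -> /=; lia.
- move=> i j b b' w lt_i lt_j eq_l eq_p.
  have def_nh : n = h * 2 by rewrite /h; lia.
  (* As k is prime to h = n / 2, k (i - j) = h e forces i - j = z h, and z is -1, 0
     or 1 because i and j are less than 2 h. *)
  pose e : int := (b'%:Z - b%:Z + w * 2)%R.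
  have eq_k : (k%:Z * (i%:Z - j%:Z) = h%:Z * e)%R.
    by move: eq_p; rewrite /e def_nh; lia.
  have [z eq_z def_z] : exists2 z : int, (i%:Z - j%:Z = z * h%:Z)%R & (z = i%:Z - j%:Z - 2 * e)%R.
    by exists (i%:Z - j%:Z - 2 * e)%R => //; move: eq_k; rewrite /h; lia.
  have z_small : z = 0%R \/ z = 1%R \/ z = (-1)%R.
    have : (`|z| < 2)%R by rewrite -(ltr_pM2r (x := h%:Z)); lia.
    lia.
  have e_val : (e * 2 = i%:Z - j%:Z - z)%R by lia.
  rewrite /h in eq_z; rewrite /e in e_val.
  case: z_small => [z0 | z1].
    rewrite z0 in eq_z e_val; have eq_ij : i = j by lia.
    split=> //; move: eq_l; rewrite eq_ij; exact: addbI.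
  (* Now i - j = h or -h is odd, and the layers and columns disagree on the
     parity of k. *)
  have odd_ij : odd i = ~~ odd j by case: z1 eq_z => -> eq_z; lia.
  move: eq_l e_val; rewrite odd_ij.
  case: z1 eq_z => -> eq_z; case: (odd j); case: (boolP (odd k));
    case: b {eq_p e eq_k def_z}; case: b' => //=; lia.
- move=> i; apply: (sep_ge_arc s_bound le_sn (z := 0%R)); rewrite /turn /h;
    case: s123 => [|[]] ->; by case: (odd i); case: (odd k) => /=; lia.
move=> i b b'; rewrite mulnS.
apply: (sep_ge_arc s_bound le_sn
    (z := if b && ~~ b' then (-1)%R else 0%R)); rewrite /turn /h r2;
  case: s123 => [|[]] -> /=;
  by case: b; case: b'; case: (odd i); case: (odd k) => /=; lia.
Qed.

(** Both vertices of a pair are in the same layer, 2k columns apart.  The layers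
    alternate and the advance is k, k - 1, k, ...; two steps move by -1 modulo 2k,
    so that each layer is exhausted by its 2k pairs. *)
Lemma labeling_r0 : r = 0 -> 0 < k -> s = 2 \/ s = 3 /\ 1 < k ->
  exists2 c, radio_labeling (@prism n s) c & Defs.span c = (n - 1) * phi k r s + 2.
Proof.
move=> r0 k_gt0 s23; have le_sn : s <= n by lia.
apply: (prism_labeling s_bound le_sn (l := fun i _ => odd i)
  (p := fun i b => i./2 * (2 * k - 1) + odd i * k + b * (2 * k))).
- by rewrite r0; case: s23 => [|[]] -> /=; lia.
- move=> i j b b' w lt_i lt_j eq_odd.
  rewrite eq_odd => eq_p.
  pose e : int := (b'%:Z - b%:Z + w * 2)%R.
  have eq_q : ((i./2)%:Z - (j./2)%:Z = ((i./2)%:Z - (j./2)%:Z - e) * (2 * k)%N%:Z)%R.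
    by move: eq_p; rewrite /e def_n r0; nia.
  have eq_ij : i./2 = j./2 by have := dvdz_small eq_q; lia.
  split; first by rewrite -(odd_double_half i) -(odd_double_half j) eq_odd eq_ij.
  have : (e = 0)%R by move: eq_q; rewrite eq_ij subrr; nia.
  by rewrite /e; case: (b); case: (b') => //; lia.
- move=> i; apply: (sep_ge_arc s_bound le_sn (z := 0%R)); rewrite /turn eqxx;
    case: s23 => [|[]] ->; lia.
move=> i b b'; rewrite /= uphalf_half.
apply: (sep_ge_arc s_bound le_sn
    (z := if b && ~~ b' then (-1)%R else 0%R)); rewrite /turn r0;
  case: s23 => [|[]] -> /=;
  by case: b; case: b'; case: (odd i) => /=; lia.
Qed.

(** Without slanted rungs, antipodal vertices lie in different layers.  Four pairs
    advancing by k run through a residue class modulo k; then the advance is k - 1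
    and the direction of the pairs is reversed, which moves to the next class. *)
Lemma labeling_r0_s1 : r = 0 -> 0 < k -> s = 1 ->
  exists2 c, radio_labeling (@prism n s) c & Defs.span c = (n - 1) * phi k r s + 2.
Proof.
move=> r0 k_gt0 s1; have le_sn : s <= n by lia.
apply: (prism_labeling s_bound le_sn (l := fun i b => odd (i %/ 4) (+) b)
  (p := fun i b => i %/ 4 * (4 * k - 1) + i %% 4 * k + b * (2 * k))).
- by rewrite r0 s1 /=; lia.
- move=> i j b b' w lt_i lt_j eq_l eq_p.
  pose e : int := ((i %% 4)%N%:Z - (j %% 4)%N%:Z + (b%:Z - b'%:Z) * 2 - w * 4)%R.
  have eq_q : ((i %/ 4)%N%:Z - (j %/ 4)%N%:Z =
      (((i %/ 4)%N%:Z - (j %/ 4)%N%:Z) * 4 + e) * k%:Z)%R.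
    by move: eq_p; rewrite /e def_n r0; nia.
  have eq_ij : i %/ 4 = j %/ 4 by have := dvdz_small eq_q; lia.
  have eq_b : b = b' by move: eq_l; rewrite eq_ij; exact: addbI.
  split=> //; have : (e = 0)%R by move: eq_q; rewrite eq_ij subrr; nia.
  by rewrite /e eq_b; lia.
- move=> i; apply: (sep_ge_arc s_bound le_sn (z := 0%R)); rewrite /turn s1;
    by case: (odd _) => /=; lia.
move=> i b b'.
have : i.+1 %/ 4 = i %/ 4 /\ i.+1 %% 4 = (i %% 4).+1 \/
  i.+1 %/ 4 = (i %/ 4).+1 /\ i.+1 %% 4 = 0 /\ i %% 4 = 3 by lia.
by case=> [[-> ->] | [-> [-> ->]]]; apply: (sep_ge_arc s_bound le_sn
    (z := if b && ~~ b' then (-1)%R else 0%R)); rewrite /turn r0 s1 /=;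
  case: b; case: b'; case: (odd _) => /=; lia.
Qed.

End Labelings.

(** * The radio numbers *)

Lemma prism_radio_number n s k r : 0 < s <= 3 -> r < 4 -> n = 4 * k + r ->
    0 < k \/ n = 3 /\ s = 3 -> ~ (n = 4 /\ s = 3) ->
  is_radio_number (@prism n s) ((n - 1) * phi k r s + 2).
Proof.
move=> s_bound lt_r def_n k_gt0 not43.
have le_sn : s <= n by lia.
have s123 : s = 1 \/ s = 2 \/ s = 3 by lia.
have r0123 : r = 0 \/ r = 1 \/ r = 2 \/ r = 3 by lia.
split.
  case: r0123 => [r0 | [r1 | [r2 | r3]]].
  - case: s123 => [s1 | s23]; first by apply: labeling_r0_s1 => //; lia.
    by apply: labeling_r0 => //; lia.
  - by apply: labeling_odd => //; left.
  - by apply: labeling_r2 => //; lia.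
  - by apply: labeling_odd => //; right.
move=> c c_radio; apply: (prism_span_ge s_bound le_sn c_radio).
  by case: s123 k_gt0 not43 => [|[|]] ->; case: r0123 def_n => [|[|[|]]] -> /=; lia.
by case: s123 k_gt0 not43 => [|[|]] ->; case: r0123 def_n => [|[|[|]]] -> /=; lia.
Qed.

Section PrismFourThree.

Let G := @prism 4 3.
Implicit Types u v : prism_vertex 4.

Lemma gdist43_le (u v : prism_vertex 4) : odd u.2 != odd v.2 -> gdist G u v <= 1.
Proof.
rewrite gdist_prism //; wlog le_uv : u v / u.2 <= v.2.
  move=> IH; case/orP: (leq_total u.2 v.2) => /IH // {}IH.
  by rewrite eq_sym pdistC.
move=> odd_uv; apply: leq_trans (@pdist_le 4 3 _ _ _ _ le_uv) _ => //.
have := ltn_ord v.2; rewrite /turn; case: (side u); case: (side v) => /=; lia.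
Qed.

Lemma gdist43_ge (u v : prism_vertex 4) : u.2 + 2 = v.2 -> 2 <= gdist G u v.
Proof.
rewrite gdist_prism // => def_v; have lt_v := ltn_ord v.2.
apply: (@sep_ge_arc 4 3 _ _ _ _ _ 0%R) => //; rewrite /turn;
  by case: (side u); case: (side v) => /=; lia.
Qed.

(** Consecutive labels need vertices at distance 2, hence columns of equal parity.
    If the labels were 1, ..., 8, all columns would have the same parity.  With one
    gap, one can label first the even columns and then the odd ones. *)
Lemma radio_number43 : is_radio_number G 9.
Proof.
have diamG : diam G = 2 by rewrite diam_prism.
have gdistC u v : gdist G u v = gdist G v u by rewrite !gdist_prism // pdistC.
split.
  pose c (u : prism_vertex 4) := (2 * u.1 + u.2 %/ 2 + 5 * odd u.2).+1.
  have c_le u : c u <= 9 by have := ltn_ord u.1; have := ltn_ord u.2; rewrite /c; lia.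
  exists c; last first.
    apply/eqP; rewrite eqn_leq; apply/andP; split; first by apply/bigmax_leqP.
    by apply: leq_trans (leq_span c (inord 1, inord 3)); rewrite /c /= !inordK.
  split=> // u v nuv; rewrite diamG.
  have d_gt0 : 0 < gdist G u v.
    rewrite gdist_prism // lt0n; apply: contra nuv => /eqP uv0; apply/eqP.
    exact: pdist_eq0 uv0.
  have := gdist43_ge (u := u) (v := v); have := gdist43_ge (u := v) (v := u).
  rewrite [gdist G v u]gdistC.
  have {}nuv : u.1 != v.1 :> nat \/ u.2 != v.2 :> nat.
    by apply/orP; rewrite -negb_and; apply: contra nuv.
  have := ltn_ord u.1; have := ltn_ord u.2; have := ltn_ord v.1; have := ltn_ord v.2.
  move: nuv d_gt0; rewrite /c.
  move: (gdist G u v) (u.1 : nat) (u.2 : nat) (v.1 : nat) (v.2 : nat).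
  clear; lia.
move=> c c_radio; rewrite leqNgt; apply/negP => lt_span.
have c_le u : c u <= 8 by apply: leq_trans (leq_span c u) _.
have c_gt0 := c_radio.1.
pose f u : 'I_8 := inord (c u).-1.
have f_val u : (f u).+1 = c u.
  by rewrite /f inordK; have := c_le u; have := c_gt0 u; lia.
have f_inj : injective f.
  by move=> u v eq_f; apply: (radio_inj c_radio); rewrite -!f_val eq_f.
have [|g fK gK] := inj_card_bij f_inj; first by rewrite card_ord card_prism.
have parity m (lt_m : m < 8) : odd (g (Ordinal lt_m)).2 = odd (g ord0).2.
  elim: m lt_m => [|m IHm] lt_m; first by congr (odd (g _).2); apply: val_inj.
  rewrite -(IHm (ltnW lt_m)); apply: contraTeq isT.
  move=> /gdist43_le le1; set x := g _ in le1; set y := g _ in le1.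
  have cx : c x = m.+2 by rewrite -f_val gK.
  have cy : c y = m.+1 by rewrite -f_val gK.
  have nxy : x != y by apply: contra_eq_neq cx => ->; rewrite cy; lia.
  by have := c_radio.2 x y nxy; rewrite diamG cx cy; lia.
have odd_const u : odd u.2 = odd (g ord0).2.
  by rewrite -(parity _ (ltn_ord (f u))) -[in LHS](fK u); congr (odd (g _).2); apply: val_inj.
have := odd_const (ord0, ord0); rewrite -(odd_const (ord0, inord 1)) /=.
by rewrite inordK.
Qed.

End PrismFourThree.

Theorem mainTheorem1 :
  (forall n s k r : nat,
     1 <= s <= 3 -> 1 <= k -> r < 4 -> n = 4 * k + r -> (n, s) <> (4, 3) ->
     is_radio_number (@prism n s) ((n - 1) * phi k r s + 2)) /\
  is_radio_number (@prism 3 3) 6 /\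
  is_radio_number (@prism 4 3) 9.
Proof.
split; last split; last exact: radio_number43.
  move=> n s k r s_bound k_gt0 lt_r def_n not43.
  apply: prism_radio_number => //; first by left.
  by case=> n4 s3; apply: not43; rewrite n4 s3.
by apply: (@prism_radio_number 3 3 0 3) => //; [right | case].
Qed.
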